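(* Let $S=(I_A,I_F,M,O)$ be a canonical Local Friendliness scenario such that $I_F=I_A$ and $|M_i|=2$ for at least $|I_A|-1$ of the parties $i\in I_A$. Then $\mathcal{LF}(S)=\mathcal{B}(S)$.
   Context: Canonical (standard) Local Friendliness (LF) scenario: a quadruple $S=(I_A,I_F,M,O)$ where $I_A=\{1,\dots,N\}$ is a finite set of parties (superobservers), $I_F\subset I_A$ (possibly empty, possibly all of $I_A$) is the set of parties having a ''friend'', $M=M_1\times\dots\times M_N$ with $M_i=\{1,\dots,m_i\}$ the finite set of measurement settings of party $i$, and for each $i$ and $x_i\in M_i$ there is a finite outcome set $O_{x_i}$ (depending on $i$ and on the setting $x_i$); for $\vec x\in M$ put $O_{\vec x}=O_{x_1}\times\dots\times O_{x_N}$, and $O=\{O_{\vec x}\}_{\vec x\in M}$. The sets $I_A$, $M_i$, $O_{x_i}$ all have cardinality at least 2. The symbol $\subset$ denotes non-strict inclusion. For $J\subset I_A$, $\vec a_J$ and $\vec x_J$ denote the substrings indexed by $J$. Behaviour: a family $\wp=(\wp(\cdot|\vec x))_{\vec x\in M}$ where $\wp(\cdot|\vec x)$ is a probability distribution on $O_{\vec x}$. $\mathcal{B}(S)$: the set of behaviours admitting a local hidden variable (LHV) model, i.e. $\wp(\vec a|\vec x)=\int_\Lambda d\lambda\,p(\lambda)\prod_{i=1}^N P(a_i|x_i,\lambda)$ for all $\vec a,\vec x$, for some probability space $(\Lambda,p)$ and, for each $i$, $x_i$, $\lambda$, a probability distribution $P(\cdot|x_i,\lambda)$ on $O_{x_i}$.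 $\mathcal{LF}(S)$: the set of behaviours $\wp$ for which there exist a probability distribution $P(\vec c)$ on strings $\vec c=(c_i)_{i\in I_F}\in\prod_{i\in I_F}O_{x_i=1}$ (here $O_{x_i=1}$ is the outcome set of party $i$'s setting $1$) and, for each $\vec c$ and $\vec x\in M$, a probability distribution $P(\cdot|\vec x,\vec c)$ on $O_{\vec x}$, such that: (1) $\wp(\vec a|\vec x)=\sum_{\vec c}P(\vec a|\vec x,\vec c)P(\vec c)$; (2) (Local Agency) for every $V\subset I_A$ the marginal $P(\vec a_V|\vec x,\vec c)$ depends on $\vec x$ only through $\vec x_V$; (3) with $F_{\vec x}=\{i\in I_F: x_i=1\}$, $P(\vec a_{F_{\vec x}}|\vec x,\vec c)=\prod_{i\in F_{\vec x}}\delta_{a_i,c_i}$. Equivalently $\wp(\vec a|\vec x)=\sum_{\vec c}\prod_{i\in F_{\vec x}}\delta_{a_i,c_i}\,P(\vec a_{J_{\vec x}}|\vec x_{J_{\vec x}},\vec c)\,P(\vec c)$ with $J_{\vec x}=I_A\setminus F_{\vec x}$, the $P(\cdot|\cdot,\vec c)$ satisfying Local Agency. If $I_F=\emptyset$, $\vec c$ is the empty string. *)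

(* Defs.v *)
From HB Require Import structures.
From mathcomp Require Import all_boot all_order all_algebra.
From mathcomp Require Import all_classical all_reals all_analysis.

Set Implicit Arguments.
Unset Strict Implicit.
Unset Printing Implicit Defensive.

Import Order.TTheory GRing.Theory Num.Theory.
Local Open Scope classical_set_scope.
Local Open Scope ring_scope.

(* Canonical Local Friendliness scenario.  The parties 1..N are the elements
   of 'I_N and the settings 1..m_i of party i are the elements of 'I_(m_i),
   so that numbering starts at 0: setting 1 of the literature is the ordinal
   of value 0. *)
Record scenario := Scenario {
  nparties : nat;
  friends : {set 'I_nparties};
  nsettings : 'I_nparties -> nat;
  outcome : forall i : 'I_nparties, 'I_(nsettings i) -> finType;
  nparties_gt1 : (1 < nparties)%N;
  nsettings_gt1 : forall i, (1 < nsettings i)%N;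
  outcome_gt1 : forall i (y : 'I_(nsettings i)), (1 < #|outcome y|)%N
}.

Definition party (S : scenario) : finType := 'I_(nparties S).

Definition setting (S : scenario) (i : party S) : finType := 'I_(nsettings i).

Definition first_setting (S : scenario) (i : party S) : setting i :=
  Ordinal (ltnW (nsettings_gt1 i)).

(* Setting strings are plain dependent functions rather than finite functions,
   so that the outcome types of a restricted setting string are convertible to
   those of the original one. *)
Definition settings (S : scenario) : Type := forall i : party S, setting i.

Definition outcomes (S : scenario) (x : settings S) : finType :=
  {dffun forall i : party S, outcome (x i)}.

(* Substrings indexed by a set J of parties. *)
Definition subparty (S : scenario) (J : {set party S}) : finType :=
  {i : party S | i \in J}.

Definition subsettings (S : scenario) (J : {set party S}) : Type :=
  forall j : subparty J, setting (val j).

Definition suboutcomes (S : scenario) (J : {set party S}) (y : subsettings J) :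
    finType :=
  {dffun forall j : subparty J, outcome (y j)}.

Definition restr_settings (S : scenario) (J : {set party S}) (x : settings S) :
    subsettings J :=
  fun j => x (val j).
Arguments restr_settings {S} J x.

Definition restr_outcomes (S : scenario) (J : {set party S}) (x : settings S)
    (a : outcomes x) : suboutcomes (restr_settings J x) :=
  [ffun j : subparty J => a (val j)].
Arguments restr_outcomes {S} J {x} a.

Definition is_distr (R : realType) (T : finType) (p : T -> R) : Prop :=
  (forall t, 0 <= p t) /\ \sum_(t : T) p t = 1.

Definition behaviour (R : realType) (S : scenario) : Type :=
  {wp : forall x : settings S, outcomes x -> R | forall x, is_distr (wp x)}.

Definition prob (R : realType) (S : scenario) (wp : behaviour R S)
    (x : settings S) (a : outcomes x) : R :=
  proj1_sig wp x a.

Definition LHV (R : realType) (S : scenario) : set (behaviour R S) :=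
  [set wp | exists (d : measure_display) (L : measurableType d)
      (p : probability L R)
      (P : forall (i : party S) (y : setting i), L -> outcome y -> R),
    [/\ forall i y l, is_distr (P i y l),
        forall i y (o : outcome y), measurable_fun setT (fun l => P i y l o)
      & forall (x : settings S) (a : outcomes x),
          (prob wp a)%:E =
          (\int[p]_l (\prod_(i : party S) P i (x i) l (a i))%:E)%E]].
Arguments LHV R S : clear implicits.

Definition marginal (R : realType) (S : scenario) (x : settings S)
    (p : outcomes x -> R) (V : {set party S})
    (aV : suboutcomes (restr_settings V x)) : R :=
  \sum_(a : outcomes x | restr_outcomes V a == aV) p a.

Definition local_agency (R : realType) (S : scenario)
    (P : forall x : settings S, outcomes x -> R) : Prop :=
  forall V : {set party S},
    exists Q : forall y : subsettings V, suboutcomes y -> R,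
      forall (x : settings S) (aV : suboutcomes (restr_settings V x)),
        marginal (P x) aV = Q (restr_settings V x) aV.

(* Strings of friends' outcomes, one for the first setting of each friend's
   superobserver. *)
Definition friend_outcomes (S : scenario) : finType :=
  suboutcomes (restr_settings (friends S) (@first_setting S)).

Definition observed (S : scenario) (x : settings S) : {set party S} :=
  [set i in friends S | x i == first_setting i].

Lemma observed_friend (S : scenario) (x : settings S)
  (j : subparty (observed x)) : val j \in friends S.
Proof. by case: j => i /=; rewrite inE => /andP[]. Qed.

(* On [observed x], a_i and c_i live in the propositionally equal types
   [outcome (x i)] and [outcome (first_setting i)]; they are compared as
   setting-outcome pairs. *)
Definition same_outcome (S : scenario) (i : party S) (y z : setting i)
    (a : outcome y) (c : outcome z) : bool :=
  Tagged (@outcome S i) a == Tagged (@outcome S i) c.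

Definition LF (R : realType) (S : scenario) : set (behaviour R S) :=
  [set wp | exists (Pc : friend_outcomes S -> R)
      (P : friend_outcomes S -> forall x : settings S, outcomes x -> R),
    [/\ is_distr Pc,
        forall c x, is_distr (P c x),
        forall (x : settings S) (a : outcomes x),
          prob wp a = \sum_(c : friend_outcomes S) P c x a * Pc c,
        forall c, local_agency (P c)
      & forall c (x : settings S)
            (aF : suboutcomes (restr_settings (observed x) x)),
          marginal (P c x) aF =
          \prod_(j : subparty (observed x))
            (same_outcome (aF j) (c (exist _ (val j) (observed_friend j))))%:R]].
Arguments LF R S : clear implicits.

(* Main.v *)
From HB Require Import structures.
Require Import Defs.
From mathcomp Require Import all_boot all_order all_algebra.
From mathcomp Require Import all_classical all_reals all_analysis.
From mathcomp Require Import measurable_realfun ring.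

Set Implicit Arguments.
Unset Strict Implicit.
Unset Printing Implicit Defensive.

Import Order.TTheory GRing.Theory Num.Theory.
Local Open Scope classical_set_scope.
Local Open Scope ring_scope.

(* A friend's record c fixes what every party outputs on its first setting, so
   given c only the remaining settings are random.  All parties but one, say k,
   have a single remaining setting, hence the string of their outcomes there can
   serve as a hidden variable: by Local Agency its law does not depend on the
   setting of k, and k answers from the conditional law of its own outcome given
   that string.  Conversely, a local hidden variable model is a mixture of
   deterministic strategies; conditioning the mixture on the outcomes that the
   strategy assigns to the first settings yields a Local Friendliness model. *)

(** * Sums over dependent functions, and hidden variables in a finite set *)

Lemma sum_dffun_prod (R : comNzRingType) (I : finType) (T : I -> finType)
    (f : forall i, T i -> R) :
  \sum_(g : {dffun forall i, T i}) \prod_i f i (g i) = \prod_i \sum_(t : T i) f i t.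
Proof.
pose P_ i := [ffun t : T i => f i t].
rewrite (reindex (@dffun_of_fprod I T)); last exact/onW_bij/dffun_of_fprod_bij.
transitivity (\sum_(g : fprod T) \prod_(i in I) P_ i (g i)).
  by apply: eq_bigr => g _; apply: eq_bigr => i _; rewrite !ffunE.
rewrite big_fprod.
rewrite -(bigA_distr_big_dep (fun i t => t \in tagged_with T i)
  (fun i => untag 0 (P_ i))); apply: eq_bigr => i _.
rewrite -(big_tag (fun i t => P_ i t)).
by apply: eq_bigr => t _; rewrite ffunE.
Qed.

(** [LHV] asks for a probability space: the weights become a sum of Dirac masses on [nat], one at
    the index of each element of [L], and on [nat] every function is measurable. *)
Lemma finite_LHV (R : realType) (S : scenario) (wp : behaviour R S)
    (L : finType) (w : L -> R)
    (P : L -> forall (i : party S) (y : setting i), outcome y -> R) :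
  is_distr w -> (forall l i y, is_distr (@P l i y)) ->
  (forall x (a : outcomes x), prob wp a = \sum_l w l * \prod_i P l i (x i) (a i)) ->
  LHV R S wp.
Proof.
move=> [w0 w1] dP wpE.
have [l0 _] : exists l : L, True.
  case: (pickP (@predT L)) => [l _|L0]; first by exists l.
  by move: w1; rewrite big_pred0 // => /esym/eqP; rewrite oner_eq0.
(* Indices from [N] on decode to [l0] but carry no mass. *)
pose lv (n : nat) := nth l0 (enum L) n.
pose N := #|L|.
pose m (n : nat) : {measure set nat -> \bar R} :=
  mscale (NngNum (w0 (lv n))) (\d_ n : {measure set nat -> \bar R}).
pose mu : {measure set nat -> \bar R} := msum m N.
have lvE (F : L -> R) : \sum_(n < N) F (lv n) = \sum_l F l.
  rewrite [RHS](reindex (@enum_val L predT)).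
    by apply: eq_bigr => n _; rewrite (enum_val_nth l0).
  exact/onW_bij/enum_val_bij.
have mu1 : (mu setT = 1)%E.
  rewrite (_ : mu setT = \sum_(n < N) (w (lv n))%:E)%E.
    by rewrite sumEFin (lvE w) w1.
  by apply: eq_bigr => n _; rewrite /= /mscale /= diracT mule1.
have intE (F : L -> R) : (forall l, 0 <= F l) ->
    (\int[mu]_n (F (lv n))%:E = (\sum_l w l * F l)%:E)%E.
  move=> F0.
  rewrite /mu ge0_integral_measure_sum //; last by move=> n _; rewrite lee_fin.
  rewrite -(lvE (fun l => w l * F l)) -sumEFin; apply: eq_bigr => n _.
  rewrite ge0_integral_mscale //; last by move=> k _; rewrite lee_fin.
  by rewrite integral_dirac //= diracT mul1e EFinM.
pose p : probability nat R :=
  HB.pack (Measure.sort mu) (Measure_isProbability.Build _ _ _ (Measure.sort mu) mu1).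
exists _, nat, p, (fun i y n => P (lv n) i y).
split=> [i y l|i y o|x a].
- exact: dP.
- by [].
- rewrite [RHS](_ : _ = (\sum_l w l * \prod_(i : party S) P l i (x i) (a i))%:E).
    by rewrite wpE.
  apply: (intE (fun l => \prod_(i : party S) P l i (x i) (a i))) => l.
  by apply: prodr_ge0 => i _; case: (dP l i (x i)).
Qed.

(** * Deterministic strategies and mixtures of them *)

Definition strategy (S : scenario) : finType :=
  {dffun forall t : {i : party S & setting i}, outcome (tagged t)}.

Definition plays (S : scenario) (g : strategy S) (x : settings S) : outcomes x :=
  [ffun i => g (Tagged (@setting S) (x i))].

Lemma prod_sigT (R : comNzRingType) (I : finType) (J : I -> finType)
    (F : {i : I & J i} -> R) :
  \prod_t F t = \prod_i \prod_(j : J i) F (Tagged J j).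
Proof.
rewrite (sig_big_dep xpredT (fun _ => xpredT) (fun i j => F (Tagged J j))) /=.
by apply: eq_bigr => -[].
Qed.

(** The product law draws the outcomes of all settings independently; the factors of settings not
    selected by [x] sum to 1. *)
Lemma sum_plays_prod (R : realType) (S : scenario)
    (f : forall (i : party S) (y : setting i), outcome y -> R)
    (x : settings S) (a : outcomes x) :
  (forall i y, \sum_o f i y o = 1) ->
  \sum_(g : strategy S | plays g x == a) \prod_t f (tag t) (tagged t) (g t) =
  \prod_i f i (x i) (a i).
Proof.
move=> f1.
(* The condition [plays g x == a] is absorbed as an indicator into the factors of the settings in
   [x], so that the sum runs over all strategies and factorises. *)
pose h (t : {i : party S & setting i}) (o : outcome (tagged t)) : R :=
  f (tag t) (tagged t) o *
  (if tagged t == x (tag t) then (same_outcome o (a (tag t)))%:R else 1).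
transitivity (\sum_(g : strategy S) \prod_t h t (g t)).
  rewrite big_mkcond; apply: eq_bigr => g _; rewrite big_split /=.
  rewrite [X in _ = _ * X]prod_sigT /=.
  have sameE i : same_outcome (g (Tagged (@setting S) (x i))) (a i) = (plays g x i == a i).
    by rewrite /same_outcome eq_Tagged ffunE.
  rewrite [X in _ = _ * X](_ : _ = \prod_i (plays g x i == a i)%:R); last first.
    apply: eq_bigr => i _; rewrite (bigD1 (x i)) //= eqxx sameE big1 ?mulr1 //.
    by move=> y /negbTE ->.
  case: eqP => [<-|/eqP ga].
    by rewrite [X in _ * X]big1 ?mulr1 // => i _; rewrite eqxx.
  have [i gai] : exists i, plays g x i != a i.
    apply/existsP; rewrite -negb_forall; apply: contra ga => /forallP ga.
    by apply/eqP/ffunP => i; apply/eqP.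
  by rewrite [X in _ * X](bigD1 i) //= (negbTE gai) mul0r mulr0.
rewrite sum_dffun_prod prod_sigT.
apply: eq_bigr => i _; rewrite (bigD1 (x i)) //= [X in _ * X]big1 ?mulr1.
  rewrite (bigD1 (a i)) //= big1 ?addr0 /h /= ?eqxx.
    by rewrite /same_outcome eqxx mulr1.
  by move=> o /negbTE oa; rewrite /same_outcome eq_Tagged /= oa mulr0.
move=> y /negbTE yx; rewrite -(f1 i y); apply: eq_bigr => o _.
by rewrite /h /= yx mulr1.
Qed.

(** As in Fine's theorem: at each [l] the outcomes of all settings are drawn independently, and the
    weight of a strategy is the integral over [l] of its probability. *)
Lemma LHV_deterministic (R : realType) (S : scenario) (wp : behaviour R S) :
  LHV R S wp ->
  exists w : strategy S -> R, is_distr w /\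
    forall x (a : outcomes x), prob wp a = \sum_(g | plays g x == a) w g.
Proof.
move=> [d [L [p [P [dP mP wpE]]]]].
pose F (g : strategy S) l := \prod_t P (tag t) (tagged t) l (g t).
have F0 g l : 0 <= F g l by apply: prodr_ge0 => t _; case: (dP (tag t) (tagged t) l).
have mF g : measurable_fun setT (F g) by apply: measurable_prod => t _; exact: mP.
have sumF x (a : outcomes x) l :
    \sum_(g | plays g x == a) F g l = \prod_i P i (x i) l (a i).
  by apply: (sum_plays_prod (f := fun i y => P i y l)) => i y; case: (dP i y l).
have F1 l : \sum_g F g l = 1.
  rewrite (sum_dffun_prod (fun t => P (tag t) (tagged t) l)) big1 // => t _.
  by case: (dP (tag t) (tagged t) l).
have intF (A : pred (strategy S)) :
    (\int[p]_l (\sum_(g | A g) F g l)%:E = \sum_(g | A g) \int[p]_l (F g l)%:E)%E.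
  rewrite -[in RHS]big_filter -ge0_integral_sum //.
  - by apply: eq_integral => l _; rewrite -big_filter sumEFin.
  - by move=> g; exact/measurable_EFinP.
  - by move=> g l _; rewrite lee_fin.
have int0 g : (0 <= \int[p]_l (F g l)%:E)%E.
  by apply: integral_ge0 => l _; rewrite lee_fin.
have int1 : (\sum_g \int[p]_l (F g l)%:E = 1)%E.
  rewrite -intF; under eq_integral do rewrite F1.
  by rewrite integral_cst //= mul1e probability_setT.
pose w g := fine (\int[p]_l (F g l)%:E).
have wE g : ((w g)%:E = \int[p]_l (F g l)%:E)%E.
  rewrite fineK // ge0_fin_numE //; apply: le_lt_trans (ltry 1).
  by rewrite -int1 (bigD1 g) //= leeDl // sume_ge0.
exists w; split.
  split=> [g|]; first exact: fine_ge0.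
  by apply: EFin_inj; rewrite -sumEFin -int1; apply: eq_bigr => g _; exact: wE.
move=> x a; apply: EFin_inj; rewrite wpE -sumEFin.
rewrite (eq_bigr _ (fun g _ => wE g)) -intF.
by apply: eq_integral => l _; rewrite sumF.
Qed.

(** * From mixtures of strategies to Local Friendliness models *)

Definition friends_record (S : scenario) (g : strategy S) : friend_outcomes S :=
  restr_outcomes (friends S) (plays g (@first_setting S)).

Lemma outcome_inhabited (S : scenario) (i : party S) (y : setting i) :
  exists o : outcome y, True.
Proof.
case: (pickP (@predT (outcome y))) => [t _|none]; first by exists t.
by have := outcome_gt1 y; rewrite (eq_card0 none).
Qed.

Definition default_outcome (S : scenario) (i : party S) (y : setting i) : outcome y :=
  projT1 (cid (outcome_inhabited y)).

(** Provides a strategy to fall back on when conditioning on a record of probability 0. *)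
Lemma friends_record_surj (S : scenario) (c : friend_outcomes S) :
  exists g, friends_record g = c.
Proof.
pose s (i : party S) : forall y : setting i, outcome y :=
  match pselect (i \in friends S) with
  | left Hi => eqtype.dfwith (@default_outcome S i) (c (exist _ i Hi))
  | right _ => @default_outcome S i
  end.
exists [ffun t => s (tag t) (tagged t)]; apply/ffunP => -[i Hi].
rewrite !ffunE /= /s; case: pselect => [Hi'|nHi]; last by case: (nHi Hi).
by rewrite (bool_irrelevance Hi' Hi) eqtype.dfwith_in.
Qed.

Lemma deterministic_LF (R : realType) (S : scenario) (wp : behaviour R S)
    (w : strategy S -> R) :
  is_distr w ->
  (forall x (a : outcomes x), prob wp a = \sum_(g | plays g x == a) w g) ->
  LF R S wp.
Proof.
move=> [w0 w1] wpE.
pose Pc c := \sum_(g | friends_record g == c) w g.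
pose ext c := projT1 (cid (@friends_record_surj S c)).
have extK c : friends_record (ext c) = c by rewrite /ext; case: cid.
have Pc0 c : 0 <= Pc c by apply: sumr_ge0.
(* [q c] is the law of the strategy given the record [c]. If that record has probability 0, the
   point mass at [ext c] keeps [q c] a distribution on strategies with record [c], since [LF]
   constrains every [c]. *)
pose q c g : R := if Pc c == 0 then (g == ext c)%:R
                  else (friends_record g == c)%:R * w g / Pc c.
have q0 c g : 0 <= q c g.
  by rewrite /q; case: ifP => // _; rewrite divr_ge0 // mulr_ge0.
have q1 c : \sum_g q c g = 1.
  rewrite /q; case: eqVneq => [_|Pcn0].
    by rewrite (bigD1 (ext c)) //= eqxx big1 ?addr0 // => g /negbTE ->.
  rewrite -mulr_suml (eq_bigr (fun g => if friends_record g == c then w g else 0)).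
    by rewrite -big_mkcond divff.
  by move=> g _; case: eqP; rewrite ?mul1r ?mul0r.
have q_supp c g : friends_record g != c -> q c g = 0.
  move=> gc; rewrite /q (negbTE gc) !mul0r; case: ifP => // _.
  by have [gE|//] := eqVneq g (ext c); rewrite gE extK eqxx in gc.
have qPc c g : q c g * Pc c = (friends_record g == c)%:R * w g.
  have [gc|/q_supp ->] := eqVneq (friends_record g) c; last by rewrite !mul0r.
  rewrite /q gc eqxx; case: eqVneq => [Pc_eq0|Pcn0]; last by rewrite mul1r divfK.
  rewrite Pc_eq0 mulr0 mul1r; apply/esym/eqP.
  have/eqP := Pc_eq0; rewrite psumr_eq0 // => /allP/(_ g).
  by rewrite mem_index_enum gc eqxx => /(_ isT).
pose P c x (a : outcomes x) := \sum_(g | plays g x == a) q c g.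
have margP c x (V : {set party S}) (aV : suboutcomes (restr_settings V x)) :
    marginal (@P c x) aV = \sum_(g | restr_outcomes V (plays g x) == aV) q c g.
  rewrite [RHS](partition_big (fun g => plays g x)
    (fun a => restr_outcomes V a == aV)) //=.
  apply: eq_bigr => a Ha; apply: eq_bigl => g.
  by case: (plays g x =P a) => [->|]; rewrite ?Ha ?andbF.
exists Pc, P; split.
- split=> //; rewrite -w1.
  by rewrite [RHS](partition_big (@friends_record S) predT).
- move=> c x; split=> [a|]; first exact: sumr_ge0.
  by rewrite -(q1 c) [RHS](partition_big (fun g => plays g x) predT).
- move=> x a; rewrite wpE.
  under [RHS]eq_bigr do rewrite mulr_suml.
  rewrite exchange_big /=; apply: eq_bigr => g _.
  under eq_bigr do rewrite qPc.
  rewrite -mulr_suml (bigD1 (friends_record g)) //= eqxx big1 ?addr0 ?mul1r //.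
  by move=> c; rewrite eq_sym => /negbTE ->.
- move=> c V.
  (* The part of [plays g x] in [V] reads only the settings in [V], which gives Local Agency
     strategy by strategy. *)
  pose gV (g : strategy S) (y : subsettings V) : suboutcomes y :=
    [ffun j => g (Tagged (@setting S) (y j))].
  exists (fun y aV => \sum_(g : strategy S | gV g y == aV) q c g) => x aV.
  rewrite margP; apply: eq_bigl => g; congr (_ == _).
  by apply/ffunP => j; rewrite !ffunE.
- move=> c x aF; rewrite margP -[RHS]mul1r -[X in X * _](q1 c) mulr_suml big_mkcond.
  apply: eq_bigr => g _.
  (* A strategy in the support has record [c], so every observed party plays its entry of [c]. *)
  have [gc|/q_supp ->] := eqVneq (friends_record g) c; last by rewrite mul0r if_same.
  have sameE j : same_outcome (aF j) (c (exist _ (val j) (observed_friend j))) =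
      (aF j == restr_outcomes (observed x) (plays g x) j).
    rewrite -gc !ffunE /=.
    have : x (val j) = first_setting (val j).
      by case: j => i /=; rewrite inE => /andP[_ /eqP].
    move: (aF j); rewrite /restr_settings /= => o /esym xj.
    by case: _ / xj o => o; rewrite /same_outcome eq_Tagged.
  under eq_bigr do rewrite sameE.
  have [<-|neq] := eqVneq.
    by rewrite big1 ?mulr1 // => j _; rewrite eqxx.
  have [j jneq] : exists j, aF j != restr_outcomes (observed x) (plays g x) j.
    apply/existsP; rewrite -negb_forall; apply: contra neq => /forallP E.
    by apply/eqP/ffunP => j; rewrite (eqP (E j)).
  by rewrite (bigD1 j) //= (negbTE jneq) mul0r mulr0.
Qed.

(** * Marginals of setting-outcome pairs *)

Definition tagged_outcome (S : scenario) (x : settings S) (a : outcomes x)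
    (i : party S) : {y : setting i & outcome y} := Tagged (@outcome S i) (a i).

(* Tagging outcomes by their settings makes marginals at different setting
   strings comparable without transport along equalities of settings. *)
Definition tagged_marginal (R : realType) (S : scenario) (x : settings S)
    (p : outcomes x -> R) (V : {set party S})
    (t : forall i : party S, {y : setting i & outcome y}) : R :=
  \sum_(a | [forall i in V, tagged_outcome a i == t i]) p a.

Lemma eq_tagged_marginal (R : realType) (S : scenario) (x : settings S)
    (p : outcomes x -> R) (V : {set party S})
    (t u : forall i : party S, {y : setting i & outcome y}) :
  {in V, forall i, t i = u i} -> tagged_marginal p V t = tagged_marginal p V u.
Proof.
by move=> tu; apply: eq_bigl => a; apply: eq_forallb_in => i /tu ->.
Qed.

(** A tagged marginal is a sum of substring marginals, and Local Agency makes these functions of the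
    restricted settings, which coincide for [x] and [x']. *)
Lemma tagged_marginal_agency (R : realType) (S : scenario)
    (P : forall x : settings S, outcomes x -> R) (V : {set party S})
    (x x' : settings S) (t : forall i : party S, {y : setting i & outcome y}) :
  local_agency P -> {in V, forall i, x i = x' i} ->
  tagged_marginal (@P x) V t = tagged_marginal (@P x') V t.
Proof.
move=> /(_ V)[Q PQ] xx'.
pose M (y : subsettings V) : R := \sum_(aV : suboutcomes y |
  [forall j, Tagged (@outcome S (val j)) (aV j) == t (val j)]) Q y aV.
have tmE z : tagged_marginal (@P z) V t = M (restr_settings V z).
  rewrite /M; under eq_bigr do rewrite -PQ.
  pose C (aV : suboutcomes (restr_settings V z)) :=
    [forall j, Tagged (@outcome S (val j)) (aV j) == t (val j)].
  have CE a : C (restr_outcomes V a) = [forall i in V, tagged_outcome a i == t i].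
    apply/forallP/forall_inP => [Ca i iV|Ca j].
      by have := Ca (exist _ i iV); rewrite ffunE.
    by rewrite ffunE; apply: Ca; exact: valP.
  rewrite /tagged_marginal (eq_bigl _ _ (fun a => esym (CE a))).
  rewrite (partition_big (restr_outcomes V) C) //=.
  apply: eq_bigr => aV CaV; apply: eq_bigl => a.
  by case: eqP => [->|]; rewrite ?CaV ?andbF.
rewrite !tmE; congr M; apply: functional_extensionality_dep => j.
by apply: xx'; exact: valP.
Qed.

Lemma tagged_marginal_eq0 (R : realType) (S : scenario) (x : settings S)
    (p : outcomes x -> R) (V : {set party S}) (a : outcomes x) :
  (forall b, 0 <= p b) -> tagged_marginal p V (tagged_outcome a) = 0 -> p a = 0.
Proof.
move=> p0 /eqP; rewrite psumr_eq0 // => /allP/(_ a).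
rewrite mem_index_enum => /(_ isT)/implyP pa; apply/eqP/pa.
by apply/forall_inP.
Qed.

Lemma sum_tagged_eq (R : realType) (S : scenario) (i : party S) (y z : setting i)
    (u : outcome z) (r : R) :
  z = y ->
  \sum_(t : outcome y | Tagged (@outcome S i) u == Tagged (@outcome S i) t) r = r.
Proof.
move=> zy; case: _ / zy.
under eq_bigl do rewrite eq_Tagged /= eq_sym.
by rewrite big_pred1_eq.
Qed.

(** * A local model at one fixed record *)

Definition second_setting (S : scenario) (i : party S) : setting i :=
  Ordinal (nsettings_gt1 i).

Lemma not_first_setting (S : scenario) (i : party S) (y : setting i) :
  #|setting i| = 2%N -> y != first_setting i -> y = second_setting i.
Proof.
rewrite card_ord => m2 yn0; apply: val_inj => /=.
have := ltn_ord y; move: yn0; rewrite -val_eqE /= [X in (_ < X)%N -> _]m2.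
by case: (val y) => [|[]].
Qed.

Lemma point_distr (R : realType) (T : finType) (t : T) :
  is_distr (fun u => (u == t)%:R : R).
Proof.
split=> [u|]; first by case: eqP.
by rewrite (bigD1 t) //= eqxx big1 ?addr0 // => u /negbTE ->.
Qed.

(* [k] plays [y] and every other party plays its second setting. *)
Definition second_but (S : scenario) (k : party S) (y : setting k) : settings S :=
  eqtype.dfwith (@second_setting S) y.

Section LocalModel.
Variables (R : realType) (S : scenario) (k : party S).
Variables (d : forall i : party S, outcome (first_setting i))
  (P : forall x : settings S, outcomes x -> R).
Hypothesis card_settings : forall i, i != k -> #|setting i| = 2%N.
Hypothesis distrP : forall x, is_distr (@P x).
Hypothesis agencyP : local_agency P.
Hypothesis suppP : forall (x : settings S) (a : outcomes x) (i : party S),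
  x i = first_setting i -> tagged_outcome a i != Tagged (@outcome S i) (d i) -> P a = 0.

Local Notation x0 := (@second_setting S).

(* Conditional law of the outcome of [i] on setting [y], given that the other
   parties obtained [b]; an arbitrary law when that event has probability 0. *)
Definition lone_response (b : outcomes x0) (i : party S) (y : setting i)
    (t : outcome y) : R :=
  let D := tagged_marginal (@P (second_but y)) [set~ i]%SET (tagged_outcome b) in
  if D == 0 then (t == default_outcome y)%:R
  else (\sum_(a : outcomes (second_but y) |
           [forall j in [set~ i]%SET, tagged_outcome a j == tagged_outcome b j] &&
           (tagged_outcome a i == Tagged (@outcome S i) t)) P a) / D.

(** A party other than [k] has two settings, so the pair on the right always carries the setting [y]
    and the answer is deterministic. *)
Definition response (b : outcomes x0) (i : party S) (y : setting i)
    (t : outcome y) : R :=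
  if i == k then lone_response b t
  else (Tagged (@outcome S i) t ==
        if y == first_setting i then Tagged (@outcome S i) (d i)
        else tagged_outcome b i)%:R.

Lemma lone_response_distr b i y : is_distr (@lone_response b i y).
Proof.
rewrite /lone_response /=; case: eqVneq => [_|Dn0]; first exact: point_distr.
split=> [t|].
  have P0 x (a : outcomes x) : 0 <= P a by case: (distrP x).
  by apply: divr_ge0; apply: sumr_ge0.
rewrite -mulr_suml -(divff Dn0); congr (_ / _).
(* Each string [a] contributes to exactly one [t], its own outcome at [i]. *)
rewrite (exchange_big_dep (fun a : outcomes (second_but y) =>
  [forall j in [set~ i]%SET, tagged_outcome a j == tagged_outcome b j])) /=; last first.
  by move=> t a _ /andP[].
apply: eq_bigr => a ->; apply: sum_tagged_eq; exact: eqtype.dfwith_in.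
Qed.

Lemma response_distr b i y : is_distr (@response b i y).
Proof.
rewrite /response; case: eqVneq => [_|ik]; first exact: lone_response_distr.
split=> [t|]; first by case: eqP.
suff sum1 : forall (z : setting i) (u : outcome z), z = y ->
    \sum_(t : outcome y) (Tagged (@outcome S i) t == Tagged (@outcome S i) u)%:R = 1 :> R.
  case: eqVneq => [/esym|/(not_first_setting (card_settings ik))/esym]; exact: sum1.
move=> z u zy; rewrite -[RHS](sum_tagged_eq u 1 zy) [RHS]big_mkcond.
by apply: eq_bigr => t _; rewrite eq_sym; case: eqP.
Qed.

Lemma second_butE (y : setting k) i : i != k -> second_but y i = x0 i.
Proof. by move=> ik; apply: eqtype.dfwith_out; rewrite eq_sym. Qed.

(** The deterministic factors force [b] to agree with [a] on the parties other than [k] at their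
    second setting. Averaging the conditional laws of [k] over such [b] gives a marginal at
    [second_but (x k)], which Local Agency moves to [x]; there the record fixes the remaining
    outcomes, so the marginal is [P a]. *)
Lemma response_model (x : settings S) (a : outcomes x) :
  P a = \sum_(b : outcomes x0) P b * \prod_i response b (a i).
Proof.
have P0 z (e : outcomes z) : 0 <= P e by case: (distrP z).
under eq_bigr => b _.
  rewrite (bigD1 k) //= {1}/response eqxx.
  rewrite (eq_bigr (fun i => (tagged_outcome a i ==
    if x i == first_setting i then Tagged (@outcome S i) (d i)
    else tagged_outcome b i)%:R)); last by move=> i /negbTE ik; rewrite /response ik.
  over.
(* If a party other than [k] contradicts the record, both sides are 0. *)
have [/existsP[i /and3P[ik /eqP xi ai]]|] := boolP [exists i, [&& i != k,
    x i == first_setting i & tagged_outcome a i != Tagged (@outcome S i) (d i)]].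
  rewrite (suppP xi ai) big1 // => b _.
  by rewrite (bigD1 i) //= xi eqxx (negbTE ai) mul0r !mulr0.
rewrite negb_exists => /forallP ad.
have {}ad i : i != k -> x i = first_setting i ->
    tagged_outcome a i = Tagged (@outcome S i) (d i).
  by move=> ik xi; have := ad i; rewrite ik xi eqxx /= negbK => /eqP.
pose A := [set i | (i != k) && (x i != first_setting i)]%SET.
have prodE (b : outcomes x0) : \prod_(i | i != k) (tagged_outcome a i ==
    if x i == first_setting i then Tagged (@outcome S i) (d i)
    else tagged_outcome b i)%:R =
    [forall i in A, tagged_outcome b i == tagged_outcome a i]%:R :> R.
  have [/forall_inP bA|] :=
    boolP [forall i in A, tagged_outcome b i == tagged_outcome a i].
    rewrite big1 // => i ik; case: (eqVneq (x i) (first_setting i)) => xi.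
      by rewrite ad // eqxx.
    by rewrite (eqP (bA i _)) ?eqxx // inE ik.
  rewrite negb_forall_in => /exists_inP[i]; rewrite inE => /andP[ik /negbTE xi].
  by move=> bi; rewrite (bigD1 i) //= xi eq_sym (negbTE bi) mul0r.
under eq_bigr do rewrite prodE.
(* [xk] is the bridge: it agrees with [x] on [k] and [A], and with [x0] off [k]. *)
pose xk := second_but (x k).
pose V := [set~ k]%SET.
have xkV : {in V, forall i, xk i = x0 i}.
  by move=> i; rewrite !inE => ik; rewrite /xk second_butE.
pose D (b : outcomes x0) := tagged_marginal (@P x0) V (tagged_outcome b).
have DE (b : outcomes x0) : tagged_marginal (@P xk) V (tagged_outcome b) = D b.
  exact: tagged_marginal_agency agencyP xkV.
pose match_on (W : {set party S}) z (e : outcomes z) (t : forall i : party S, _) :=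
  [forall i in W, tagged_outcome e i == t i].
have AV (b : outcomes x0) (e : outcomes xk) : match_on V xk e (tagged_outcome b) ->
    match_on A x0 b (tagged_outcome a) = match_on A xk e (tagged_outcome a).
  move=> /forall_inP eb; apply: eq_forallb_in => i iA.
  by rewrite (eqP (eb i _)) //; move: iA; rewrite !inE => /andP[].
have termE (b : outcomes x0) : P b * (lone_response b (a k) *
      (match_on A x0 b (tagged_outcome a))%:R) =
    \sum_(e : outcomes xk | tagged_outcome e k == tagged_outcome a k)
      if match_on V xk e (tagged_outcome b)
      then P e * (match_on A xk e (tagged_outcome a))%:R * (P b / D b) else 0.
  (* The default law in [lone_response] carries no weight: if [D b] is 0, so is [P b]. *)
  have [Pb0|Pbn0] := eqVneq (P b) 0.
    by rewrite Pb0 mul0r big1 // => e _; rewrite mul0r mulr0 if_same.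
  have Dn0 : D b != 0.
    by apply: contra_neq Pbn0; apply: tagged_marginal_eq0.
  rewrite -big_mkcondr /lone_response DE (negbTE Dn0) mulrCA -mulrA mulr_suml.
  apply: eq_big => e; first by rewrite andbC.
  by move=> /andP[/AV -> _]; ring.
rewrite (eq_bigr _ (fun b _ => termE b)) exchange_big /=.
transitivity (tagged_marginal (@P xk) (k |: A)%SET (tagged_outcome a)).
  rewrite (@tagged_marginal_agency _ _ _ _ xk x) //; last first.
    move=> i; rewrite !inE => /predU1P[->|/andP[ik xi]].
      exact: eqtype.dfwith_in.
    rewrite /xk second_butE //; apply/esym/not_first_setting => //.
    exact: card_settings.
  rewrite /tagged_marginal (bigD1 a) /=; last by apply/forall_inP.
  (* Any other string agreeing with [a] on [k |: A] differs from it at a party on its first setting,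
     hence contradicts the record and has probability 0. *)
  rewrite big1 ?addr0 // => e /andP[/forall_inP ea nea].
  have [i] : exists i, e i != a i.
    apply/existsP; rewrite -negb_forall; apply: contra nea => /forallP E.
    by apply/eqP/ffunP => i; apply/eqP.
  have [iA|] := boolP (i \in k |: A)%SET.
    by have := ea i iA; rewrite /tagged_outcome eq_Tagged /= => ->.
  rewrite !inE !negb_or negb_and negbK => /andP[ik].
  rewrite (negbTE ik) /= negbK => /eqP xi ei.
  apply: (suppP xi); rewrite -(ad i ik xi).
  by rewrite /tagged_outcome eq_Tagged.
rewrite /tagged_marginal big_mkcond [RHS]big_mkcond; apply: eq_bigr => e _.
have -> : [forall i in (k |: A)%SET, tagged_outcome e i == tagged_outcome a i] =
    (tagged_outcome e k == tagged_outcome a k) && match_on A xk e (tagged_outcome a).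
  apply/forall_inP/andP => [ea|[ek /forall_inP eA] i].
    split; first by apply: ea; rewrite setU11.
    by apply/forall_inP => i iA; apply: ea; rewrite setU1r.
  by rewrite in_setU1 => /predU1P[->|/eA].
case: (_ == _) => //=.
have [Pe0|Pen0] := eqVneq (P e) 0.
  by rewrite Pe0 if_same big1 // => b _; rewrite !mul0r if_same.
(* By Local Agency [De] is also the marginal at [xk] of an event containing [e], so [P e != 0]
   excludes [De = 0]. *)
pose De := tagged_marginal (@P x0) V (tagged_outcome e).
have Den0 : De != 0.
  apply: contra_neq Pen0 => De0; apply: (tagged_marginal_eq0 (V := V)) => //.
  by rewrite -De0; exact: tagged_marginal_agency agencyP xkV.
(* The strings [b] matching [e] on [V] have total weight [De], so the quotients [P b / De] sum to
   1. *)
rewrite -big_mkcond -mulr_sumr.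
rewrite (eq_bigr (fun b => P b / De)); last first.
  move=> b /forall_inP eb; congr (_ / _); apply: eq_tagged_marginal => i iV.
  by rewrite (eqP (eb i iV)).
rewrite -mulr_suml (_ : \sum_(b | _) _ = De); last first.
  by apply: eq_bigl => b; apply: eq_forallb => i; rewrite eq_sym.
by rewrite divff // mulr1; case: ifP; rewrite ?mulr1 ?mulr0.
Qed.
End LocalModel.

(** * Mixing over the records, and equality of the two sets *)

Lemma LF_sub_LHV (R : realType) (S : scenario) (k : party S) :
  friends S = [set: party S]%SET ->
  (forall i : party S, i != k -> #|setting i| = 2%N) ->
  LF R S `<=` LHV R S.
Proof.
move=> friendsT card2 wp [Pc [P [[Pc0 Pc1] distrP wpE agencyP recordP]]].
have friendP (i : party S) : i \in friends S by rewrite friendsT inE.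
pose d (c : friend_outcomes S) (i : party S) : outcome (first_setting i) :=
  c (exist _ i (friendP i)).
have suppP c (x : settings S) (a : outcomes x) (i : party S) :
    x i = first_setting i -> tagged_outcome a i != Tagged (@outcome S i) (d c i) ->
    P c x a = 0.
  move=> xi ai.
  have iF : i \in observed x by rewrite inE friendP xi eqxx.
  have P0 b : 0 <= P c x b by case: (distrP c x).
  (* [P c x a] is a nonnegative term of the marginal on the observed parties, and the factor of [i]
     makes that marginal 0. *)
  have := recordP c x (restr_outcomes (observed x) a).
  rewrite (bigD1 (exist _ i iF)) //= ffunE /=.
  rewrite (bool_irrelevance (observed_friend (exist _ i iF))
    (friendP i : is_true (val (exist _ i iF) \in friends S))).
  rewrite /same_outcome (negbTE ai) mul0r => /eqP.
  rewrite psumr_eq0 // => /allP/(_ a).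
  by rewrite mem_index_enum eqxx => /(_ isT)/eqP.
(* The hidden variable pairs the record with the outcomes at the second settings. *)
apply: (finite_LHV (L := (friend_outcomes S * outcomes (@second_setting S))%type)
  (w := fun l => Pc l.1 * P l.1 _ l.2)
  (P := fun l => response k (d l.1) (P l.1) l.2)).
- split=> [[c b]|]; first by rewrite mulr_ge0 //; case: (distrP c (@second_setting S)).
  rewrite -(pair_bigA _ (fun c b => Pc c * P c _ b)) /= -Pc1.
  apply: eq_bigr => c _; rewrite -mulr_sumr.
  by case: (distrP c (@second_setting S)) => _ ->; rewrite mulr1.
- by move=> [c b] i y; apply: response_distr.
- move=> x a; rewrite wpE -(pair_bigA _ (fun c b => Pc c * P c _ b *
    \prod_i response k (d c) (P c) b (a i))) /=.
  apply: eq_bigr => c _; rewrite (response_model (k := k) (d := d c)) //; last first.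
    exact: suppP.
  rewrite mulrC mulr_sumr; apply: eq_bigr => b _; exact: mulrA.
Qed.

Theorem corollary15 (R : realType) (S : scenario)
    (hF : friends S = [set: party S]%SET)
    (hM : (nparties S - 1 <= #|[set i : party S | #|setting i| == 2]%SET|)%N) :
  LF R S = LHV R S.
Proof.
have [k card2] : exists k : party S, forall i, i != k -> #|setting i| = 2%N.
  pose A := [set i : party S | #|setting i| == 2]%SET.
  have : (#|~: A|%SET <= 1)%N.
    rewrite -(leq_add2l #|A|) cardsC card_ord.
    by rewrite addnC -leq_subLR.
  move=> /card_le1_eqP A1.
  have [/eqP A0|] := boolP (~: A == finset.set0)%SET.
    (* If every party has two settings, any party can serve as [k]. *)
    exists (Ordinal (ltnW (nparties_gt1 S))) => i _.
    by have /setP/(_ i) := A0; rewrite !inE => /negbFE/eqP.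
  case/set0Pn => k kA; exists k => i ik; apply/eqP.
  by apply: contraNT ik => iA; rewrite (A1 i k) // !inE.
apply/seteqP; split; first exact: LF_sub_LHV card2.
by move=> wp /LHV_deterministic[w [dw wpE]]; apply: deterministic_LF dw wpE.
Qed.
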